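(* Let $N\ge3$ and let $u^0,\dots,u^N$ be functions of $(x,j)\in\mathbb R\times\mathbb Z$. Put $\gamma^n=e^{u^n-u^{n+1}_1}$ for $0\le n\le N-1$. Consider the equations for functions $A,B,\hat A,\hat B$ of $(x,j)$ $$\begin{aligned} &A_1=A,\quad A_x+\left(u^0_x+u^1_{1,x}+e^{u^0-u^1_1}\right)A=0,\\ &B_1=B,\quad B_x=\left(u^0_x+u^1_x+e^{u^1-u^2_1}\right)B,\\ &\hat A_1=\hat A,\quad \hat A_x=\left(u^N_x+u^{N-1}_{-1,x}+e^{u^{N-1}_{-1}-u^N}\right)\hat A,\\ &\hat B_1=\hat B,\quad \hat B_x=-\left(u^N_x+u^{N-1}_x+e^{u^{N-2}_{-1}-u^{N-1}}\right)\hat B,\end{aligned}\qquad( * )$$ together with the linear equations for $\phi=(\phi^1,\dots,\phi^{N-1})^T$, $\rho=(\rho^1,\dots,\rho^{N-1})^T$ $$\begin{pmatrix} D\phi \\ D^{-1}\rho \end{pmatrix}=\begin{pmatrix} u_{11} & u_{12} \\ u_{21} & u_{22} \end{pmatrix}\begin{pmatrix} \phi \\ \rho \end{pmatrix},\qquad \begin{pmatrix} \phi_x \\ \rho_x \end{pmatrix}=\begin{pmatrix} v_{11} & v_{12} \\ v_{21} & v_{22} \end{pmatrix}\begin{pmatrix} \phi \\ \rho \end{pmatrix},\qquad( ** )$$ where $A,B,\hat A,\hat B$ are particular solutions of $( * )$, all blocks are $(N-1)\times(N-1)$, and the nonzero entries are as follows: - $u_{11}$ has all diagonal entries $1$ and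 $(u_{11})_{n+1,n}=\gamma^n$ for $1\le n\le N-2$; - $u_{12}$ has the single nonzero entry $(u_{12})_{1,1}=A\gamma^0$; - $u_{21}$ has the single nonzero entry $(u_{21})_{N-1,N-1}=\hat A\gamma^{N-1}$; - $u_{22}$ has all diagonal entries $1$ and $(u_{22})_{n,n+1}=\gamma^n$ for $1\le n\le N-2$; - $(v_{11})_{n,n}=-u^n_x$ for $1\le n\le N-2$, $(v_{11})_{N-1,N-1}=-u^{N-1}_x-\gamma^{N-3}_{-1}$, and $(v_{11})_{n,n+1}=1$ for $1\le n\le N-2$; - $v_{12}$ has the single nonzero entry $(v_{12})_{N-1,N-1}=\hat B$; - $v_{21}$ has the single nonzero entry $(v_{21})_{1,1}=-B$; - $(v_{22})_{1,1}=\gamma^0+u^1_{1,x}$, $(v_{22})_{n,n}=u^n_{1,x}$ for $2\le n\le N-1$, and $(v_{22})_{n+1,n}=-1$ for $1\le n\le N-2$. Then the compatibility conditions for the equations $( * )$, $( ** )$ lead to the system $$\begin{aligned} u^0_x-u^0_{1,x}&=e^{u^1_1-u^2_2}-e^{u^0-u^1_1},\\ u^n_x-u^n_{1,x}&=e^{u^{n-1}-u^n_1}-e^{u^n-u^{n+1}_1},\qquad 1\le n\le N-1,\\ u^N_x-u^N_{1,x}&=e^{u^{N-1}-u^N_1}-e^{u^{N-2}_{-1}-u^{N-1}}.\end{aligned}$$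
   Context: For a function $f=f(x,j)$ of a continuous variable $x$ and a discrete variable $j\in\mathbb Z$, write $f_k=f(x,j+k)$ (also for negative $k$), $f_x=\partial_xf$, $f_{k,x}=\partial_x f(x,j+k)$; in particular $\gamma^{n}_{-1}=e^{u^{n}_{-1}-u^{n+1}}$. $D$ is the shift $Df=f_1$. The functions $A,B,\hat A,\hat B$ are determined by $( * )$ up to constant factors and are chosen so that $AB=-1$, $\hat A\hat B=-1$. The compatibility conditions are the requirements that differentiation in $x$ and the shift in $j$ commute on $A,B,\hat A,\hat B,\phi,\rho$. *)

(* Defs.v *)
From HB Require Import structures.
From mathcomp Require Import all_boot all_order all_algebra.
From mathcomp Require Import all_classical all_reals all_analysis.

Set Implicit Arguments.
Unset Strict Implicit.
Unset Printing Implicit Defensive.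

Import Order.TTheory GRing.Theory Num.Theory.
Import numFieldNormedType.Exports.

Local Open Scope ring_scope.

(* The family u^0, ..., u^N is indexed by nat; only u n with n <= N is used. *)

Section Definitions.
Context {R : realType}.

Definition dx (f : R -> int -> R) (x : R) (j : int) : R := derive1 (f ^~ j) x.

Definition gam (u : nat -> R -> int -> R) (n : nat) (x : R) (j : int) : R :=
  expR (u n x j - u n.+1 x (j + 1)).

(* f_1 = f and f_x = c f, including the differentiability of f in x. *)
Definition scalar_solution (c f : R -> int -> R) : Prop :=
  forall (x : R) (j : int),
    f x (j + 1) = f x j /\ is_derive x (1 : R) (f ^~ j) (c x j * f x j).

Definition scalar_eqs (N : nat) (u : nat -> R -> int -> R)
    (A B Ah Bh : R -> int -> R) : Prop :=
  [/\ scalar_solution (fun x j =>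
        - (dx (u 0%N) x j + dx (u 1%N) x (j + 1)
           + expR (u 0%N x j - u 1%N x (j + 1)))) A,
      scalar_solution (fun x j =>
        dx (u 0%N) x j + dx (u 1%N) x j
        + expR (u 1%N x j - u 2%N x (j + 1))) B,
      scalar_solution (fun x j =>
        dx (u N) x j + dx (u (N - 1)%N) x (j - 1)
        + expR (u (N - 1)%N x (j - 1) - u N x j)) Ah &
      scalar_solution (fun x j =>
        - (dx (u N) x j + dx (u (N - 1)%N) x j
           + expR (u (N - 2)%N x (j - 1) - u (N - 1)%N x j))) Bh].

(* Square matrix given by its entries with rows and columns numbered from 1. *)
Definition mx1 (m : nat) (f : nat -> nat -> R) : 'M[R]_m :=
  \matrix_(i < m, k < m) f i.+1 k.+1.

Section LinearProblem.
Variables (N : nat) (u : nat -> R -> int -> R) (A B Ah Bh : R -> int -> R).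

Definition u11 (x : R) (j : int) : 'M[R]_(N - 1) := mx1 _ (fun a b =>
  if a == b then 1 else if a == b.+1 then gam u b x j else 0).

Definition u12 (x : R) (j : int) : 'M[R]_(N - 1) := mx1 _ (fun a b =>
  if (a == 1%N) && (b == 1%N) then A x j * gam u 0 x j else 0).

Definition u21 (x : R) (j : int) : 'M[R]_(N - 1) := mx1 _ (fun a b =>
  if (a == (N - 1)%N) && (b == (N - 1)%N)
  then Ah x j * gam u (N - 1) x j else 0).

Definition u22 (x : R) (j : int) : 'M[R]_(N - 1) := mx1 _ (fun a b =>
  if a == b then 1 else if b == a.+1 then gam u a x j else 0).

Definition v11 (x : R) (j : int) : 'M[R]_(N - 1) := mx1 _ (fun a b =>
  if a == b then
    if a == (N - 1)%N
    then - dx (u (N - 1)%N) x j - gam u (N - 3) x (j - 1)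
    else - dx (u a) x j
  else if b == a.+1 then 1 else 0).

Definition v12 (x : R) (j : int) : 'M[R]_(N - 1) := mx1 _ (fun a b =>
  if (a == (N - 1)%N) && (b == (N - 1)%N) then Bh x j else 0).

Definition v21 (x : R) (j : int) : 'M[R]_(N - 1) := mx1 _ (fun a b =>
  if (a == 1%N) && (b == 1%N) then - B x j else 0).

Definition v22 (x : R) (j : int) : 'M[R]_(N - 1) := mx1 _ (fun a b =>
  if a == b then
    if a == 1%N
    then gam u 0 x j + dx (u 1%N) x (j + 1)
    else dx (u a) x (j + 1)
  else if a == b.+1 then - 1 else 0).

Definition dx_mx (m : nat) (M : R -> int -> 'M[R]_m) (x : R) (j : int) :
    'M[R]_m :=
  \matrix_(i < m, k < m) dx (fun y l => M y l i k) x j.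

(* The shift equations between the values (p, r) of (phi, rho) at (x, j) and
   (p', r') at (x, j + 1): the equation for D phi is taken at j, the one for
   D^-1 rho at j + 1. They determine (p', r') from (p, r) and conversely, and
   leave (p, r) arbitrary. *)
Definition shift_eqs (x : R) (j : int) (p r p' r' : 'cV[R]_(N - 1)) : Prop :=
  p' = u11 x j *m p + u12 x j *m r /\
  r = u21 x (j + 1) *m p' + u22 x (j + 1) *m r'.

Definition phi_x (x : R) (j : int) (p r : 'cV[R]_(N - 1)) : 'cV[R]_(N - 1) :=
  v11 x j *m p + v12 x j *m r.

Definition rho_x (x : R) (j : int) (p r : 'cV[R]_(N - 1)) : 'cV[R]_(N - 1) :=
  v21 x j *m p + v22 x j *m r.

(* D (phi_x) = (D phi)_x and D^-1 (rho_x) = (D^-1 rho)_x, where the right-hand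
   sides are expanded by the product rule and every x-derivative of phi and rho
   is eliminated by the linear equations, identically in the values of
   (phi, rho). For A, B, Ah, Bh, which are genuine functions solving
   [scalar_eqs], the commutation of the derivative with the shift is
   automatic and needs no separate hypothesis. *)
Definition compatible : Prop :=
  forall (x : R) (j : int) (p r p' r' : 'cV[R]_(N - 1)),
    shift_eqs x j p r p' r' ->
    let px := phi_x x j p r in
    let rx := rho_x x j p r in
    let px' := phi_x x (j + 1) p' r' in
    let rx' := rho_x x (j + 1) p' r' in
    px' = dx_mx u11 x j *m p + u11 x j *m px
          + (dx_mx u12 x j *m r + u12 x j *m rx) /\
    rx = dx_mx u21 x (j + 1) *m p' + u21 x (j + 1) *m px'
         + (dx_mx u22 x (j + 1) *m r' + u22 x (j + 1) *m rx').

End LinearProblem.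
End Definitions.

(* Main.v *)
(* With AB = -1, the logarithmic derivatives of A and B are opposite, which is
   the equation for n = 1; the invariance of A under the shift then gives the
   equation for n = 0. The pair of Ah and Bh gives n = N - 1 and n = N in the
   same way. The linear problem is needed only for 2 <= n <= N - 2, where the
   equation is the coefficient of phi^n in the n-th row of
   D (phi_x) = (D phi)_x. *)

Require Import Defs.
From HB Require Import structures.
From mathcomp Require Import all_boot all_order all_algebra.
From mathcomp Require Import all_classical all_reals all_analysis.
From mathcomp Require Import ring lra zify.

Set Implicit Arguments.
Unset Strict Implicit.
Unset Printing Implicit Defensive.

Import Order.TTheory GRing.Theory Num.Theory.
Import numFieldNormedType.Exports.

Local Open Scope ring_scope.

(** The functions $f(\cdot,j+1)$ and $f(\cdot,j)$ coincide, hence so do their derivatives $c_1f_1$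
    and $cf$; the nonzero factor $f$ cancels. *)
Lemma scalar_solution_shift (R : realType) (c f : R -> int -> R) :
  (forall x j, f x j != 0) -> scalar_solution c f ->
  forall x j, c x (j + 1) = c x j.
Proof.
move=> f0 hf x j; have [_ d0] := hf x j; have [_ d1] := hf x (j + 1).
have fE : f ^~ (j + 1) = f ^~ j by apply/funext => y; have [] := hf y j.
apply: (mulIf (f0 x j)); rewrite -[LHS](_ : c x (j + 1) * f x (j + 1) = _).
  by rewrite -(@derive_val _ _ _ _ _ _ _ d1) -(@derive_val _ _ _ _ _ _ _ d0) fE.
by have [-> _] := hf x j.
Qed.

(** The product $fg$ is constant in $x$, so its derivative $(c+d)fg$ vanishes, while $fg=-1$. *)
Lemma scalar_solution_opp (R : realType) (c d f g : R -> int -> R) :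
  (forall x j, f x j * g x j = -1) ->
  scalar_solution c f -> scalar_solution d g ->
  forall x j, c x j + d x j = 0.
Proof.
move=> fg hf hg x j; have [_ df] := hf x j; have [_ dg] := hg x j.
have dfg := is_deriveM df dg.
have fgE : (f ^~ j * g ^~ j : R -> R) = cst (-1).
  by apply/funext => y; rewrite -[RHS](fg y j).
have : 'D_1 (f ^~ j * g ^~ j : R -> R) x = 0 by rewrite fgE derive_cst.
rewrite (@derive_val _ _ _ _ _ _ _ dfg) /GRing.scale /=.
have -> : f x j * (d x j * g x j) + g x j * (c x j * f x j)
          = (c x j + d x j) * (f x j * g x j) by ring.
by rewrite fg mulrN1 => /eqP; rewrite oppr_eq0 => /eqP.
Qed.

(** Serves the bidiagonal blocks [u11] and [v11]. *)
Lemma mulmx_two_entries (R : pzRingType) (m : nat) (M : 'M[R]_m) (v : 'cV[R]_m)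
    (i k l : 'I_m) :
  k != l -> (forall a, a != k -> a != l -> M i a = 0) ->
  (M *m v) i 0 = M i k * v k 0 + M i l * v l 0.
Proof.
move=> kl M0; rewrite mxE (bigD1 k) //= (bigD1 l) 1?eq_sym //= big1 ?addr0 //.
by move=> a /andP[ak al]; rewrite M0 ?mul0r.
Qed.

Lemma mulmx_row0 (R : pzRingType) (m p : nat) (M : 'M[R]_m) (v : 'M[R]_(m, p))
    (i : 'I_m) (k : 'I_p) :
  (forall a, M i a = 0) -> (M *m v) i k = 0.
Proof. by move=> M0; rewrite mxE big1 // => a _; rewrite M0 mul0r. Qed.

Lemma dx_cst (R : realType) (c : R) (x : R) (j : int) :
  dx (fun _ _ => c) x j = 0.
Proof. by rewrite /dx derive1E derive_cst. Qed.

(** Testing compatibility on $\phi=e_n$, $D\rho=0$ isolates the coefficient of $\phi^n$; row $n$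
    then reads $\gamma^n-u^n_{1,x}=\gamma^{n-1}-u^n_x$. *)
Lemma compatible_inner (R : realType) (N : nat) (u : nat -> R -> int -> R)
    (A B Ah Bh : R -> int -> R) (n : nat) (x : R) (j : int) :
  (2 <= n)%N -> (n < N - 1)%N -> compatible N u A B Ah Bh ->
  dx (u n) x j - dx (u n) x (j + 1) = gam u (n - 1) x j - gam u n x j.
Proof.
move=> n2 nN hc.
have ltp : (n - 2 < N - 1)%N by lia.
have lti : (n - 1 < N - 1)%N by lia.
(* Ordinals count from 0: [k], [i], [l] stand for the indices $n-1$, $n$, $n+1$ of the blocks. *)
pose k : 'I_(N - 1) := Ordinal ltp.
pose i : 'I_(N - 1) := Ordinal lti.
pose l : 'I_(N - 1) := Ordinal nN.
have iS : i.+1 = n by rewrite /=; lia.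
have kS : k.+1 = (n - 1)%N by rewrite /=; lia.
have lS : l.+1 = n.+1 by [].
have ki : k != i by rewrite -val_eqE /=; lia.
have il : i != l by rewrite -val_eqE /=; lia.
pose p : 'cV[R]_(N - 1) := delta_mx i 0.
pose p' := u11 N u x j *m p.
pose r := u21 N u Ah x (j + 1) *m p'.
have sh : shift_eqs u A Ah x j p r p' 0.
  split; last by rewrite mulmx0 addr0.
  (* [u21] produces only component $N-1$ and [u12] reads only component $1$; these differ as
     $N-1>n\ge2$, so [u12] kills [r]. *)
  rewrite /r mulmxA [X in X *m p'](_ : _ = 0) ?mul0mx ?addr0 //.
  apply/matrixP => a b; rewrite !mxE big1 // => c _; rewrite !mxE.
  case: ifP; last by rewrite mul0r.
  move=> /andP[_ /eqP c1]; rewrite ifF ?mulr0 //.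
  by apply/negbTE; rewrite negb_and c1; apply/orP; left; lia.
have [/matrixP /(_ i 0) + _] := hc x j p r p' 0 sh.
have p'E a : p' a 0 = u11 N u x j a i by rewrite /p' -colE mxE.
have addE (X Y : 'cV[R]_(N - 1)) a : (X + Y) a 0 = X a 0 + Y a 0 by rewrite mxE.
have v11E a : (v11 N u x j *m p) a 0 = v11 N u x j a i by rewrite -colE mxE.
(* Left side: row $n$ of [v11] at $j+1$ meets $p'_n=1$ and $p'_{n+1}=\gamma^n$. *)
rewrite /phi_x mulmx0 addr0 (mulmx_two_entries _ il); last first.
  move=> a ai al; rewrite mxE iS !ifF //; apply/negbTE.
  - by move: al; rewrite -val_eqE /=; lia.
  - by move: ai; rewrite -val_eqE /=; lia.
rewrite !addE.
(* Both [u12] terms live in row $1$, and $n\ge2$. *)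
rewrite (@mulmx_row0 _ _ _ (dx_mx (u12 N u A) x j)); last first.
  move=> a; rewrite mxE [X in dx X](_ : _ = fun _ _ => 0) ?dx_cst //.
  by apply/funext => y; apply/funext => s; rewrite mxE ifF // iS; lia.
rewrite (@mulmx_row0 _ _ _ (u12 N u A x j)); last first.
  by move=> a; rewrite mxE ifF // iS; lia.
have -> : (dx_mx (u11 N u) x j *m p) i 0 = 0.
  rewrite -colE 2!mxE [X in dx X](_ : _ = fun _ _ => 1) ?dx_cst //.
  by apply/funext => y; apply/funext => s; rewrite mxE eqxx.
(* Right side: row $n$ of [u11] combines components $n-1$ and $n$ of $\phi_x$, which are $1$ and
   $-u^n_x$ because [v12] acts only in row $N-1>n$. *)
rewrite !addr0 add0r !p'E (mulmx_two_entries _ ki); last first.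
  move=> a ak ai; rewrite mxE iS !ifF //; apply/negbTE.
  - by move: ak; rewrite -val_eqE /=; lia.
  - by move: ai; rewrite -val_eqE /=; lia.
rewrite !addE !v11E.
rewrite (@mulmx_row0 _ _ _ (v12 N Bh x j)); last first.
  by move=> a; rewrite mxE ifF // kS; lia.
rewrite (@mulmx_row0 _ _ _ (v12 N Bh x j)); last first.
  by move=> a; rewrite mxE ifF // iS; lia.
rewrite !mxE iS kS lS !eqxx.
have n1n : (n - 1 < n)%N by lia.
have -> : (n - 1).+1 = n by lia.
rewrite eqxx (ltn_eqF nN) (ltn_eqF (ltnSn n)) (gtn_eqF (ltnSn n)).
rewrite (ltn_eqF n1n) (gtn_eqF n1n) !addr0 !mulr1 !mul1r; lra.
Qed.

Theorem lemma7 (R : realType) (N : nat) (u : nat -> R -> int -> R)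
    (A B Ah Bh : R -> int -> R)
    (hN : (3 <= N)%N)
    (hu : forall (n : nat) (x : R) (j : int), (n <= N)%N ->
            derivable (u n ^~ j) x (1 : R))
    (hscalar : scalar_eqs N u A B Ah Bh)
    (hAB : forall (x : R) (j : int), A x j * B x j = -1)
    (hABh : forall (x : R) (j : int), Ah x j * Bh x j = -1)
    (hcompat : compatible N u A B Ah Bh) :
  forall (x : R) (j : int),
    [/\ dx (u 0%N) x j - dx (u 0%N) x (j + 1)
          = expR (u 1%N x (j + 1) - u 2%N x (j + 2))
            - expR (u 0%N x j - u 1%N x (j + 1)),
        forall n : nat, (1 <= n <= N - 1)%N ->
          dx (u n) x j - dx (u n) x (j + 1)
          = expR (u (n - 1)%N x j - u n x (j + 1))
            - expR (u n x j - u n.+1 x (j + 1)) &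
        dx (u N) x j - dx (u N) x (j + 1)
          = expR (u (N - 1)%N x j - u N x (j + 1))
            - expR (u (N - 2)%N x (j - 1) - u (N - 1)%N x j)].
Proof.
have [hA hB hAh hBh] := hscalar.
have neq0 (f g : R -> int -> R) : (forall x j, f x j * g x j = -1) ->
    forall x j, f x j != 0.
  move=> fg x j; apply: contra_eq_neq (fg x j) => ->.
  by rewrite mul0r eq_sym oppr_eq0 oner_eq0.
have sA := scalar_solution_shift (neq0 _ _ hAB) hA.
have sAh := scalar_solution_shift (neq0 _ _ hABh) hAh.
have oAB := scalar_solution_opp hAB hA hB.
have oABh := scalar_solution_opp hABh hAh hBh.
move=> x j; split.
(* Taking $AB=-1$ at $j+1$ rewrites the shifted coefficient of $A$ through that of $B$, so that
   $u^1_{1,x}$ cancels. *)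
- have := sA x j; have := oAB x (j + 1); rewrite -!addrA /=; lra.
- move=> n /andP[n1 nN].
  have [->|n_neq1] := eqVneq n 1%N; first by have := oAB x j; rewrite /=; lra.
  have [->|n_neqN] := eqVneq n (N - 1)%N.
    (* The coefficient of $\hat A$ involves $u^{N-1}_{-1}$, hence the evaluation at $j+1$. *)
    have := oABh x (j + 1); rewrite !addrK.
    rewrite (_ : N - 1 - 1 = N - 2)%N; last by lia.
    rewrite (_ : (N - 1).+1 = N); last by lia.
    by lra.
  have := @compatible_inner _ N u A B Ah Bh n x j _ _ hcompat.
  rewrite /gam (_ : (n - 1).+1 = n); last by lia.
  by apply; lia.
(* Here the unshifted coefficient of $\hat A$ is replaced, and $u^{N-1}_x$ cancels. *)
- have := sAh x j; have := oABh x j; rewrite !addrK; lra.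
Qed.
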